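(* Let $\mathbb{X}_1,\mathbb{X}_2$ be metrizable topological spaces with their Borel $\sigma$-algebras, and let $\mathbb{Y}$ be a measurable space whose $\sigma$-algebra is countably generated and contains all singletons. Let $\mu_1,\mu_2$ be $\sigma$-finite Radon measures on $\mathbb{X}_1,\mathbb{X}_2$ respectively, with $\mu_2$ finite. Let $\mathbb{X}=\mathbb{X}_1\times\mathbb{X}_2$, $\mu=\mu_1\times\mu_2$, let $h_1\colon\mathbb{X}_1\to\mathbb{Y}$ be measurable with $(h_1)_\star\mu_1$ $\sigma$-finite, and let $h\colon\mathbb{X}\to\mathbb{Y}$, $h(x_1,x_2)=h_1(x_1)$. Then, for $h_\star\mu$-almost every $y\in\mathbb{Y}$, $$\mu_2(\mathbb{X}_2)\,\mu^h(\,\cdot\mid y)=\mu_1^{h_1}(\,\cdot\mid y)\times\mu_2.$$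
   Context: Disintegration: given a measurable map $h\colon\mathbb{X}\to\mathbb{Y}$ and a measure $\mu$ on $\mathbb{X}$, a disintegration of $\mu$ with respect to $h$ is a map $(A,y)\mapsto\mu^h(A\mid y)\in[0,\infty]$ such that $\mu^h(\,\cdot\mid y)$ is a measure on $\mathbb{X}$ for all $y\in\mathbb{Y}$, $y\mapsto\mu^h(A\mid y)$ is measurable for every measurable $A\subset\mathbb{X}$, (i) $\mu^h(\mathbb{X}\setminus h^{-1}(\{y\})\mid y)=0$, and (ii) $\mu(A)=\int_{\mathbb{Y}}\mu^h(A\mid y)\,h_\star\mu(dy)$ for every measurable $A$, where $h_\star\mu$ is the pushforward. When $\mathbb{X}$ is metrizable with Borel $\sigma$-algebra, $\mu$ is $\sigma$-finite Radon, $h_\star\mu$ is $\sigma$-finite, and the $\sigma$-algebra of $\mathbb{Y}$ is countably generated and contains singletons, it exists and is unique up to $h_\star\mu$-null sets of $y$. The $\sigma$-algebra used on $\mathbb{X}=\mathbb{X}_1\times\mathbb{X}_2$ is the Borel $\sigma$-algebra, taken to be equal to the product of the Borel $\sigma$-algebras of $\mathbb{X}_1$ and $\mathbb{X}_2$. *)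

(* Defs.v *)
From HB Require Import structures.
From mathcomp Require Import all_boot all_order all_algebra.
From mathcomp Require Import all_classical all_reals all_analysis.

Set Implicit Arguments.
Unset Strict Implicit.
Unset Printing Implicit Defensive.

Import Order.TTheory GRing.Theory Num.Theory.

Local Open Scope classical_set_scope.
Local Open Scope ring_scope.

(* The carrier of borel T is T itself, so sets and functions on T are also sets
   and functions on borel T.  MathComp-Analysis requires a measurableType to be
   pointed, hence ptopologicalType. *)
Notation borel T := (g_sigma_algebraType (@open T)).

Definition metrizable (R : realType) (T : topologicalType) : Prop :=
  exists dist : T -> T -> R,
    [/\ forall x, dist x x = 0,
        forall x y, dist x y = 0 -> x = y,
        forall x y, dist x y = dist y x,
        forall y x z, dist x z <= dist x y + dist y z
      & forall x (A : set T),
          nbhs x A <-> exists2 e, 0 < e & [set y | dist x y < e] `<=` A].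

Definition countably_generated d (T : measurableType d) : Prop :=
  exists2 G : set (set T), countable G & (measurable : set (set T)) = <<s G >>.

Local Open Scope ereal_scope.

(* On a metrizable space, finiteness on compact sets together with inner
   regularity also implies local finiteness. *)
Definition radon (R : realType) (T : ptopologicalType)
    (mu : {measure set (borel T) -> \bar R}) : Prop :=
  (forall K : set T, compact K -> mu K < +oo) /\
  (forall A : set (borel T), measurable A ->
     mu A = ereal_sup [set mu K | K in [set K : set T | compact K /\ K `<=` A]]).

(* muh y A stands for mu^h(A | y); that muh y is a measure and that
   y |-> muh y A is measurable for measurable A are part of muh being a kernel. *)
Definition is_disintegration (R : realType) d d' (X : measurableType d)
    (Y : measurableType d') (mu : {measure set X -> \bar R}) (h : X -> Y)
    (muh : R.-ker Y ~> X) : Prop :=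
  (forall y, muh y (~` (h @^-1` [set y])) = 0) /\
  (forall A, measurable A -> mu A = \int[pushforward mu h]_y muh y A).

(* Main.v *)
(** A measure on a product is determined by rectangles.  For a rectangle
    [A1 `*` A2] with [mu1 A1 < +oo], both sides of the identity are integrable
    functions of [y] with the same integrals over measurable subsets of [Y], as
    the disintegrations live on the fibers of [h] and [h1]; hence they agree for
    almost every [y].  To get a single null set for all measurable sets one needs
    a countable determining class, although [X1] and [X2] need not be separable:
    a sigma-finite Radon measure is carried by a countable union [S] of compact
    sets, and countably many balls generate the trace on [S] of the Borel
    sigma-algebra. *)
Require Import Defs.
From HB Require Import structures.
From mathcomp Require Import all_boot all_order all_algebra.
From mathcomp Require Import all_classical all_reals all_analysis.

Set Implicit Arguments.
Unset Strict Implicit.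
Unset Printing Implicit Defensive.

Import Order.TTheory GRing.Theory Num.Theory.

Local Open Scope classical_set_scope.
Local Open Scope ring_scope.
Local Open Scope ereal_scope.

(** * Metric topology: countable bases along compact sets *)

Section metrizable.
Variables (R : realType) (T : ptopologicalType).

Lemma metrizable_hausdorff : metrizable R T -> hausdorff_space T.
Proof.
move=> [dist [dist0 distI distC distT distN]] p q clpq.
apply: contrapT => pq; pose e := (dist p q / 2)%R.
(* Nonnegativity is not an axiom of [metrizable]; it comes from
   [dist x x <= dist x y + dist y x]. *)
have dge0 x y : (0 <= dist x y)%R.
  have := distT y x x; rewrite dist0 (distC y x) -mulr2n.
  by rewrite pmulrn_lge0.
have e0 : (0 < e)%R.
  rewrite divr_gt0// lt_neqAle dge0 andbT eq_sym.
  by apply/eqP => /distI.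
have [] := clpq [set y | dist p y < e]%R [set y | dist q y < e]%R.
- by apply/distN; exists e.
- by apply/distN; exists e.
move=> z [/= pz qz]; have := distT z p q.
by rewrite (distC z q) leNgt (splitr (dist p q)) ltrD.
Qed.

(** For each radius 1/(k+1), finitely many balls cover the compact [K n]. All these balls together
    are countably many, and the small ones give a base at every point of the union. *)
Lemma metrizable_countable_base_on_compacts (K : (set T)^nat) :
  metrizable R T -> (forall n, compact (K n)) ->
  exists2 b : (set T)^nat, forall i, open (b i) &
    forall U x, open U -> U x -> (\bigcup_n K n) x ->
      exists2 i, b i x & b i `<=` U.
Proof.
move=> [dist [dist0 distI distC distT distN]] cK.
pose B k (x : T) := [set y | dist x y < k.+1%:R^-1]%R.
have oB k x : open (B k x).
  rewrite openE => y /= xy; apply/distN.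
  exists (k.+1%:R^-1 - dist x y)%R; first by rewrite subr_gt0.
  move=> z /=; rewrite ltrBrDl => xyz.
  by rewrite /B/= (le_lt_trans (distT y x z)).
have Bx k x : B k x x by rewrite /B/= dist0 invr_gt0.
have /choice[D HD] (p : nat * nat) : exists D : seq T,
    K p.1 `<=` \bigcup_(d in [set` D]) B p.2 d.
  have := cK p.1; rewrite compact_cover.
  move=> /(_ _ setT (B p.2))[||D _ KD] //.
  - by move=> x _; exists x.
  - by exists (finmap.enum_fset D) => x /KD[d /= dD Bd]; exists d.
(* Natural numbers encode triples (compact set, radius, position of the centre). The default values
   [setT] and [point] are harmless, since every [b i] only has to be open. *)
pose b (i : nat) : set T :=
  if @unpickle (nat * nat * nat)%type i is Some (n, k, j)
  then B k (nth point (D (n, k)) j) else setT.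
exists b => [i|U x oU Ux [n _ Knx]].
  by rewrite /b; case: unpickle => [[[n k] j]|]; [exact: oB|exact: openT].
have /distN[e e0 eU] : nbhs x U by exact: open_nbhs_nbhs.
(* Half of [e]: the ball is centred at [d], not at [x], so [y] is reached from [x] through [d]. *)
have [k ke] : exists k, (k.+1%:R^-1 < e / 2)%R.
  exists (Num.truncn (e / 2)^-1); rewrite invf_plt ?posrE ?divr_gt0//.
  exact: truncnS_gt.
have [d /= dD Bdx] := HD (n, k) x Knx.
exists (pickle (n, k, index d (D (n, k)))); rewrite /b pickleK nth_index// => y.
rewrite /B/= => dy; apply: eU => /=; rewrite (le_lt_trans (distT d x y))//.
by rewrite (distC x d) (splitr e) ltrD// (lt_trans _ ke).
Qed.

End metrizable.

(** * Radon measures: a sigma-compact carrier *)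

Section radon.
Variables (R : realType) (T : ptopologicalType).

Lemma compact_borel (K : set T) : metrizable R T -> compact K ->
  measurable (K : set (borel T)).
Proof.
move=> /metrizable_hausdorff hT /(compact_closed hT)/closed_openC oK.
rewrite -[K]setCK; apply: measurableC; exact: sub_sigma_algebra.
Qed.

(** Inner regularity fills each piece [E n] of finite measure by compact sets up to 1/(k+1). What
    the union of all of them misses in [E n] is therefore null. *)
Lemma radon_sigma_compact_carrier
    (mu : {sigma_finite_measure set (borel T) -> \bar R}) :
  metrizable R T -> radon mu ->
  exists2 K : (set T)^nat, forall n, compact (K n) &
    mu (~` (\bigcup_n K n)) = 0.
Proof.
move=> mT [_ innerreg].
have [E [TE _ mE]] := (sigma_finiteP _ _).1 (sigma_finiteT mu).
have /choice[K HK] (p : nat * nat) : exists K : set T,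
    [/\ compact K, K `<=` E p.1 & mu (E p.1) - (p.2.+1%:R^-1)%:E < mu K].
  have [mEp Eoo] := mE p.1.
  have [||_ [K [cK KE] <-]] := @ub_ereal_sup_adherent R
    [set mu K | K in [set K : set T | compact K /\ K `<=` E p.1]] p.2.+1%:R^-1%R.
  - by rewrite invr_gt0.
  - by rewrite -innerreg// ge0_fin_numE.
  - by rewrite -innerreg// => ?; exists K.
have mK p : measurable (K p : set (borel T)).
  by apply: compact_borel => //; have [] := HK p.
pose L i : set T := if unpickle i is Some p then K p else set0.
have mL i : measurable (L i : set (borel T)).
  by rewrite /L; case: unpickle.
have mUL : measurable (\bigcup_n L n : set (borel T)).
  exact: bigcupT_measurable.
exists L => [i|].
  rewrite /L; case: unpickle => [p|]; last exact: compact0.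
  by have [] := HK p.
have -> : ~` (\bigcup_n L n) = \bigcup_n (E n `\` (\bigcup_k L k)).
  by rewrite -setI_bigcupl -TE setTI.
apply/negligibleP.
  by apply: bigcupT_measurable => n; apply: measurableD => //; exact: (mE n).1.
apply: negligible_bigcup => n; have [mEn Enoo] := mE n.
apply/negligibleP; first exact: measurableD.
apply/eqP; rewrite eq_le measure_ge0 andbT.
apply/lee_addgt0Pr => e e0; rewrite add0e.
have [k ke] : exists k, (k.+1%:R^-1 < e)%R.
  exists (Num.truncn e^-1); rewrite invf_plt ?posrE//; exact: truncnS_gt.
have [_ KE muK] := HK (n, k).
apply: (@le_trans _ _ (mu (E n `\` K (n, k)))).
  apply: le_measure; rewrite ?inE; [exact: measurableD..|].
  apply: setDS => x Kx; exists (pickle (n, k)) => //.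
  by rewrite /L pickleK.
rewrite measureD// setIidr// leeBlDr; last first.
  by rewrite ge0_fin_numE// (le_lt_trans _ Enoo)// le_measure ?inE.
move: muK; rewrite lteBlDr// => /ltW/le_trans; apply.
by rewrite addeC leeD// lee_fin ltW.
Qed.

End radon.

(** * Sigma-algebras up to traces on a set *)

Lemma sigma_algebra_mod (T : Type) (M : set (set T)) (S : set T) :
  sigma_algebra setT M ->
  sigma_algebra setT [set A | exists A', M A' /\ A `&` S = A' `&` S].
Proof.
move=> [M0 MD MU]; split.
- by exists set0.
- move=> A [A' [MA' AA']]; exists (setT `\` A'); split; first exact: MD.
  have setCS B : ~` B `&` S = S `\` (B `&` S).
    by rewrite setDIr setDv setU0 setDE setIC.
  by rewrite !setTD !setCS AA'.
- move=> A /choice/=[A' HA']; exists (\bigcup_n A' n); split.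
    by apply: MU => n; have [] := HA' n.
  by rewrite !setI_bigcupl; apply: eq_bigcup => // n _; have [] := HA' n.
Qed.

(** By [sigma_algebra_mod] only open sets need checking, and on [S] the preimage of an open [U] is
    the union of the preimages of those [b n] that lie inside [U]. The map [f] will be a projection
    of the product. *)
Lemma borel_preimage_mod (Z : Type) (T : topologicalType) (M : set (set Z))
    (S : set Z) (f : Z -> T) (b : (set T)^nat) :
  sigma_algebra setT M -> (forall i, M (f @^-1` b i)) ->
  (forall U z, open U -> U (f z) -> S z -> exists2 i, b i (f z) & b i `<=` U) ->
  forall A, <<s @open T >> A ->
    exists A', M A' /\ f @^-1` A `&` S = A' `&` S.
Proof.
move=> sM Mb Sb; have [D0 DD DU] := sigma_algebra_mod S sM.
apply: smallest_sub; first split.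
- by rewrite /= preimage_set0.
- by move=> A; rewrite /= setTD preimage_setC -setTD; exact: DD.
- by move=> F; rewrite /= preimage_bigcup; exact: DU.
move=> U oU /=; have [M0 _ MU] := sM.
exists (\bigcup_n if `[< b n `<=` U >] then f @^-1` b n else set0); split.
  by apply: MU => n; case: ifP.
apply/seteqP; split => z [Uz Sz]; split => //.
  have [i biz bU] := Sb U z oU Uz Sz.
  by exists i => //; rewrite asboolT.
by case: Uz => n _; case: asboolP => // bU /bU.
Qed.


(** * General properties of a disintegration *)

Section disintegration.
Context d d' (R : realType) (X : measurableType d) (Y : measurableType d').
Variables (mu : {measure set X -> \bar R}) (h : X -> Y) (muh : R.-ker Y ~> X).
Hypotheses (mh : measurable_fun [set: X] h)
  (singY : forall y : Y, measurable [set y])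
  (muhP : is_disintegration mu h muh).

(** [muh y] is carried by the fiber over [y], which lies inside the preimage of [B] or is disjoint
    from it according to whether [y] is in [B]. *)
Lemma disintegration_fiber (A : set X) (B : set Y) (y : Y) :
  measurable A -> measurable B ->
  muh y (A `&` h @^-1` B) = ((muh ^~ A) \_ B) y.
Proof.
move=> mA mB.
have mpre C : measurable C -> measurable (h @^-1` C).
  by move=> mC; rewrite -[X in measurable X]setTI; exact: mh.
have fib0 C : measurable C -> C `<=` ~` (h @^-1` [set y]) -> muh y C = 0.
  move=> mC Cy; apply: subset_measure0 Cy (muhP.1 y) => //.
  exact/measurableC/mpre.
rewrite patchE; case: ifPn => [/[!inE] By|/negP/[!inE] By].
- rewrite [RHS](measureDI _ mA (mpre _ mB)) [X in _ = X + _]fib0 ?add0e//.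
    by apply: measurableD => //; exact: mpre.
  by move=> x [_ nBx] /= hxy; apply: nBx; rewrite /= hxy.
- rewrite fib0//; first by apply: measurableI => //; exact: mpre.
  by move=> x [_ /= Bx] /= hxy; apply: By; rewrite -hxy.
Qed.

(** Localizes the disintegration formula to subsets of [Y], so that integrands can be compared
    almost everywhere. *)
Lemma disintegration_setI (A : set X) (B : set Y) :
  measurable A -> measurable B ->
  mu (A `&` h @^-1` B) = \int[pushforward mu h]_(y in B) muh y A.
Proof.
move=> mA mB; rewrite muhP.2; last first.
  by apply: measurableI => //; rewrite -[X in measurable X]setTI; exact: mh.
rewrite [RHS]integral_mkcond; apply: eq_integral => y _.
exact: disintegration_fiber.
Qed.

Variable nu : {measure set Y -> \bar R}.
Hypothesis nuE : nu = pushforward mu h :> (set Y -> \bar R).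

Lemma disintegration_null (A : set X) : measurable A -> mu A = 0 ->
  \forall y \ae nu, muh y A = 0.
Proof.
move=> mA muA0; have mk := measurable_kernel muh _ mA.
suff : ae_eq nu setT (muh ^~ A) (cst 0) by apply: filterS => y /(_ I).
apply/ae_eq_integral_abs => //.
rewrite -muA0 muhP.2// -nuE; apply: eq_integral => y _.
by rewrite gee0_abs.
Qed.

Lemma disintegration_integrable (A : set X) : measurable A -> mu A < +oo ->
  nu.-integrable setT (muh ^~ A).
Proof.
move=> mA muAoo; have mk := measurable_kernel muh _ mA.
apply/integrableP; split => //; rewrite (le_lt_trans _ muAoo)// muhP.2// -nuE.
by rewrite le_eqVlt (eq_integral (muh ^~ A)) ?eqxx// => y _; rewrite gee0_abs.
Qed.

End disintegration.

Lemma exists_pushforward_measure d d' (R : realType) (X : measurableType d)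
    (Y : measurableType d') (mu : {measure set X -> \bar R}) (h : X -> Y) :
  measurable_fun [set: X] h ->
  exists nu : {measure set Y -> \bar R},
    nu = pushforward mu h :> (set Y -> \bar R).
Proof.
by move=> mh; unshelve eexists (pushforward mu h : {measure set Y -> \bar R}).
Qed.

(** * The identity on rectangles *)

Section product_disintegration.
Context d1 d2 d' (R : realType) (X1 : measurableType d1)
  (X2 : measurableType d2) (Y : measurableType d').
Variables (mu1 : {measure set X1 -> \bar R})
  (mu2 : {finite_measure set X2 -> \bar R}) (h1 : X1 -> Y) (h : X1 * X2 -> Y).
Hypotheses (mh1 : measurable_fun [set: X1] h1)
  (hE : forall x1 x2, h (x1, x2) = h1 x1)
  (singY : forall y : Y, measurable [set y]).
Variables (muh : R.-ker Y ~> (X1 * X2)%type) (mu1h1 : R.-ker Y ~> X1).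
Hypotheses (muhP : is_disintegration (mu1 \x mu2) h muh)
  (mu1h1P : is_disintegration mu1 h1 mu1h1).
Variable nu : {measure set Y -> \bar R}.
Hypothesis nuE : nu = pushforward mu1 h1 :> (set Y -> \bar R).

Let h_fst : h = h1 \o fst.
Proof. by apply/funext => -[x1 x2]; rewrite hE. Qed.

Let mh : measurable_fun [set: X1 * X2] h.
Proof. by rewrite h_fst; exact: measurableT_comp. Qed.

Let preimage_h (B : set Y) : h @^-1` B = (h1 @^-1` B) `*` setT.
Proof. by rewrite h_fst; apply/seteqP; split => -[x1 x2] //= -[]. Qed.

Let mh1B (B : set Y) : measurable B -> measurable (h1 @^-1` B).
Proof. by move=> mB; rewrite -[X in measurable X]setTI; exact: mh1. Qed.

(** The source of the factor [mu2 setT]; it also makes [nu]-null sets null for the pushforward of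
    the product. *)
Lemma pushforward_prod (B : set Y) : measurable B ->
  pushforward (mu1 \x mu2) h B = mu2 setT * nu B.
Proof.
move=> mB; rewrite /pushforward preimage_h product_measure1E//; last exact: mh1B.
by rewrite nuE muleC.
Qed.

Lemma disintegration_rectangle (A1 : set X1) (A2 : set X2) :
  measurable A1 -> measurable A2 -> mu1 A1 < +oo ->
  \forall y \ae nu, mu2 setT * muh y (A1 `*` A2) = mu1h1 y A1 * mu2 A2.
Proof.
move=> mA1 mA2 mu1A1.
have mA : measurable (A1 `*` A2) by exact: measurableX.
have mf := measurable_kernel muh _ mA.
have mg := measurable_kernel mu1h1 _ mA1.
have mfB B := measurable_funS measurableT (@subsetT _ B) mf.
have mgB B := measurable_funS measurableT (@subsetT _ B) mg.
(* The sides are swapped: the function whose integrability follows from [mu1 A1 < +oo] comes first,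
   and the other one is only shown measurable. *)
suff : ae_eq nu setT (fun y => mu1h1 y A1 * mu2 A2)
                     (fun y => mu2 setT * muh y (A1 `*` A2)).
  by apply: filterS => y /(_ I) ->.
have mu2fin B : measurable B -> mu2 B \is a fin_num by exact: fin_num_measure.
have mu2K : mu2 setT = (fine (mu2 setT))%:E by rewrite fineK// mu2fin.
apply: integral_ae_eq => //.
- rewrite -(fineK (mu2fin _ mA2)); apply: integrableZr => //.
  exact: (disintegration_integrable mu1h1P).
- by rewrite mu2K; exact: measurable_funeM.
move=> B _ mB.
rewrite ge0_integralZr// ge0_integralZl//.
rewrite [X in \int[X]_(x in _) _]nuE.
rewrite -(disintegration_setI mh1 singY mu1h1P mA1 mB).
have [muh' muh'E] := exists_pushforward_measure (mu1 \x mu2) mh.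
have c0 : (0 <= fine (mu2 setT))%R by exact: fine_ge0.
pose c := NngNum c0.
(* The constant moves from the integrand to the measure, where [mu2 setT] times [nu] is the
   pushforward of the product that [muh] disintegrates. *)
transitivity (\int[mscale c nu]_(y in B) muh y (A1 `*` A2)); last first.
  by rewrite ge0_integral_mscale//= -mu2K.
rewrite (eq_measure_integral muh'); last first.
  by move=> C mC _; rewrite muh'E pushforward_prod//= /mscale/= -mu2K.
rewrite muh'E -(disintegration_setI mh singY muhP mA mB) preimage_h.
by rewrite -setXI setIT [RHS]product_measure1E//;
  apply: measurableI => //; exact: mh1B.
Qed.

End product_disintegration.

(** * From rectangles to all measurable sets *)

Lemma ae_forall_countable d (T : measurableType d) (R : realType)
    (mu : {measure set T -> \bar R}) (I : countType) (P : I -> T -> Prop) :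
  (forall i, \forall x \ae mu, P i x) -> \forall x \ae mu, forall i, P i x.
Proof.
move=> aeP.
have : \forall x \ae mu, forall n, if unpickle n is Some i then P i x else True.
  by apply: ae_foralln => n; case: unpickle => [i|]; [exact: aeP|exact: aeW].
by apply: filterS => x Px i; have := Px (pickle i); rewrite pickleK.
Qed.

(** Both measures ignore the complement of [S], so [A] may be replaced by a set of the sigma-algebra
    generated by [G] with the same trace; there the uniqueness theorem for pi-systems applies. *)
Lemma measure_eq_mod_null d (T : measurableType d) (R : realType)
    (G : set (set T)) (E : (set T)^nat) (S : set T)
    (m1 m2 : {measure set T -> \bar R}) :
  G `<=` measurable -> setI_closed G ->
  (forall n, G (E n)) -> \bigcup_n E n = setT ->
  (forall n, m1 (E n) < +oo) -> (forall A, G A -> m1 A = m2 A) ->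
  measurable S -> m1 (~` S) = 0 -> m2 (~` S) = 0 ->
  (forall A, measurable A -> exists A', <<s G >> A' /\ A `&` S = A' `&` S) ->
  forall A, measurable A -> m1 A = m2 A.
Proof.
move=> GM GI GE TE m1E m12 mS m1S m2S GS A mA; have [A' [GA' AA']] := GS A mA.
have mA' : measurable A'.
  by apply: GA'; split => //; exact: sigma_algebra_measurable.
have modS (m : {measure set T -> \bar R}) B : m (~` S) = 0 -> measurable B ->
    m B = m (B `&` S).
  move=> mS0 mB; rewrite (measureDI m mB mS) (@subset_measure0 _ _ _ m _ (~` S)).
  - by rewrite add0e.
  - exact: measurableD.
  - exact: measurableC.
  - by move=> x [].
  - by [].
rewrite modS// AA' -modS// (modS m2)// AA' -modS//.
exact: (g_sigma_algebra_measure_unique _ GM _ GE TE _ _ GI m12 m1E).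
Qed.

Theorem lemma2p7 (R : realType) (X1 X2 : ptopologicalType)
    (dY : measure_display) (Y : measurableType dY)
    (metrX1 : metrizable R X1) (metrX2 : metrizable R X2)
    (borelX : (measurable : set (set (borel X1 * borel X2))) =
              <<s @open (X1 * X2)%type >>)
    (cgY : countably_generated Y) (singY : forall y : Y, measurable [set y])
    (mu1 : {sigma_finite_measure set (borel X1) -> \bar R})
    (mu2 : {finite_measure set (borel X2) -> \bar R})
    (radon1 : radon mu1) (radon2 : radon mu2)
    (h1 : borel X1 -> Y) (mh1 : measurable_fun [set: borel X1] h1)
    (sfh1 : sigma_finite [set: Y] (pushforward mu1 h1))
    (h : borel X1 * borel X2 -> Y) (hE : forall x1 x2, h (x1, x2) = h1 x1)
    (muh : R.-ker Y ~> (borel X1 * borel X2)%type)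
    (muhP : is_disintegration (mu1 \x mu2) h muh)
    (mu1h1 : R.-ker Y ~> borel X1)
    (mu1h1P : is_disintegration mu1 h1 mu1h1) :
  \forall y \ae pushforward (mu1 \x mu2) h,
    forall A : set (borel X1 * borel X2), measurable A ->
      mu2 [set: borel X2] * muh y A = (mu1h1 y \x mu2) A.
Proof.
have [nu nuE] := exists_pushforward_measure mu1 mh1.
suff [N [mN N0 NP]] : \forall y \ae nu,
    forall A : set (borel X1 * borel X2), measurable A ->
      mu2 [set: borel X2] * muh y A = (mu1h1 y \x mu2) A.
  exists N; split => //.
  by rewrite (pushforward_prod mu2 mh1 hE nuE mN) N0 mule0.
have rect := disintegration_rectangle mh1 hE singY muhP mu1h1P nuE.
have [K1 cK1 mu1K1] := radon_sigma_compact_carrier metrX1 radon1.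
have [K2 cK2 mu2K2] := radon_sigma_compact_carrier metrX2 radon2.
have [b1 ob1 b1K] := metrizable_countable_base_on_compacts metrX1 cK1.
have [b2 ob2 b2K] := metrizable_countable_base_on_compacts metrX2 cK2.
have [E [X1E ndE mE]] := (sigma_finiteP _ _).1 (sigma_finiteT mu1).
pose S1 : set (borel X1) := \bigcup_n K1 n.
pose S2 : set (borel X2) := \bigcup_n K2 n.
have mS1 : measurable S1.
  by apply: bigcupT_measurable => n; exact: compact_borel metrX1 (cK1 n).
have mS2 : measurable S2.
  by apply: bigcupT_measurable => n; exact: compact_borel metrX2 (cK2 n).
(* Finite intersections are coded by sequences: concatenation gives stability under intersection,
   the empty sequence gives the whole space, and the codes stay countable. *)
pose g1 (s : seq nat) : set (borel X1) := \big[setI/setT]_(i <- s) b1 i.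
pose g2 (s : seq nat) : set (borel X2) := \big[setI/setT]_(i <- s) b2 i.
have mg1 s : measurable (g1 s).
  by apply: bigsetI_measurable => i _; exact: sub_sigma_algebra.
have mg2 s : measurable (g2 s).
  by apply: bigsetI_measurable => i _; exact: sub_sigma_algebra.
have mEg n s : measurable (E n `&` g1 s).
  by apply: measurableI => //; have [] := mE n.
have muEg n s : mu1 (E n `&` g1 s) < +oo.
  have [mEn Enoo] := mE n; apply: le_lt_trans Enoo.
  by apply: le_measure; rewrite ?inE.
pose G : set (set (borel X1 * borel X2)) :=
  [set (E p.1.1 `&` g1 p.1.2) `*` g2 p.2 | p in setT].
pose S := S1 `*` S2.
have mS : measurable S by exact: measurableX.
have GM : G `<=` measurable by move=> _ [p _ <-]; exact: measurableX.
(* Monotonicity makes the intersection of two pieces the one of smaller index, as [GI] requires. *)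
have subE k l : (k <= l)%N -> E k `<=` E l by move=> kl; exact/subsetPset/ndE.
have GI : setI_closed G.
  move=> _ _ [p _ <-] [q _ <-].
  exists (minn p.1.1 q.1.1, p.1.2 ++ q.1.2, p.2 ++ q.2) => //=.
  rewrite -setXI /g1 /g2 !big_cat/= setIACA; congr ((_ `&` _) `*` _).
  apply/seteqP; split => [x Ex|x /=]; last by case: leqP => _ [].
  by split; apply: subE Ex; rewrite ?geq_minl ?geq_minr.
have GE n : G (E n `*` setT).
  by exists (n, [::], [::]) => //=; rewrite /g1 /g2 !big_nil setIT.
have TE : \bigcup_n (E n `*` [set: borel X2]) = setT.
  apply/seteqP; split => // -[x1 x2] _.
  have : (\bigcup_n E n) x1 by rewrite -X1E.
  by move=> [n _ Enx]; exists n.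
have GS A : measurable A -> exists A', <<s G >> A' /\ A `&` S = A' `&` S.
  have sG := smallest_sigma_algebra setT G.
  have [sG0 _ sGU] := sG.
  have sG1 A1 : measurable A1 ->
      exists A', <<s G >> A' /\ fst @^-1` A1 `&` S = A' `&` S.
    apply: (borel_preimage_mod sG) => [i|U z oU Uz [Sz _]]; last exact: b1K.
    (* The cylinder over [b1 i] is recovered from members of [G] by letting the pieces [E n] exhaust
       [X1]. *)
    rewrite (_ : _ @^-1` _ = \bigcup_n ((E n `&` g1 [:: i]) `*` g2 [::])).
      by apply: sGU => n; apply: sub_gen_smallest; exists (n, [:: i], [::]).
    rewrite -setX_bigcupl -setI_bigcupl -X1E setTI /g1 /g2 big_seq1 big_nil.
    by apply/seteqP; split => -[x1 x2]//= -[].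
  have sG2 A2 : measurable A2 ->
      exists A', <<s G >> A' /\ snd @^-1` A2 `&` S = A' `&` S.
    apply: (borel_preimage_mod sG) => [i|U z oU Uz [_ Sz]]; last exact: b2K.
    rewrite (_ : _ @^-1` _ = \bigcup_n ((E n `&` g1 [::]) `*` g2 [:: i])).
      by apply: sGU => n; apply: sub_gen_smallest; exists (n, [::], [:: i]).
    rewrite -setX_bigcupl -setI_bigcupl -X1E setTI /g1 /g2 big_seq1 big_nil.
    by apply/seteqP; split => -[x1 x2]//= -[].
  move: A; apply: smallest_sub; first exact: sigma_algebra_mod.
  by move=> A [] [B mB <-]; rewrite setTI; [exact: sG1|exact: sG2].
have aeG : \forall y \ae nu, forall p : nat * seq nat * seq nat,
    mu2 setT * muh y ((E p.1.1 `&` g1 p.1.2) `*` g2 p.2) =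
    mu1h1 y (E p.1.1 `&` g1 p.1.2) * mu2 (g2 p.2).
  by apply: ae_forall_countable => p; apply: rect;
    [exact: mEg|exact: mg2|exact: muEg].
have aeE : \forall y \ae nu, forall n, mu1h1 y (E n) < +oo.
  apply: ae_foralln => n; have [mEn Enoo] := mE n.
  have /(integrable_ae measurableT) :=
    disintegration_integrable mu1h1P nuE mEn Enoo.
  by apply: filterS => y /(_ I); rewrite ge0_fin_numE.
have aeS1 : \forall y \ae nu, mu1h1 y (~` S1) = 0.
  by apply: (disintegration_null mu1h1P nuE) => //; exact: measurableC.
have aeS1T : \forall y \ae nu,
    mu2 setT * muh y (~` S1 `*` setT) = mu1h1 y (~` S1) * mu2 setT.
  by apply: rect => //; [exact: measurableC|rewrite [ltLHS]mu1K1].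
(* The strip over the complement of [S2] is cut along [E n], since [rect] asks for a first factor of
   finite [mu1]-measure. *)
have aeES2 : \forall y \ae nu, forall n,
    mu2 setT * muh y (E n `*` ~` S2) = mu1h1 y (E n) * mu2 (~` S2).
  by apply: ae_foralln => n; have [] := mE n; move=> *; apply: rect => //;
    exact: measurableC.
near=> y => A mA.
have c0 : (0 <= fine (mu2 setT))%R by exact: fine_ge0.
pose m1 : {measure set (borel X1 * borel X2) -> \bar R} :=
  mscale (NngNum c0) (muh y).
pose m2 : {measure set (borel X1 * borel X2) -> \bar R} := mu1h1 y \x mu2.
have m1E B : m1 B = mu2 setT * muh y B.
  by rewrite /m1/= /mscale/= fineK// fin_num_measure.
have m2E B1 B2 : measurable B1 -> measurable B2 ->
  m2 (B1 `*` B2) = mu1h1 y B1 * mu2 B2 by exact: product_measure1E.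
have m12 B : G B -> m1 B = m2 B.
  by move=> [p _ <-]; rewrite m1E m2E//; exact: (near aeG y).
have mCS1 := measurableC mS1; have mCS2 := measurableC mS2.
have nullS (m : {measure set (borel X1 * borel X2) -> \bar R}) :
    m (~` S1 `*` setT) = 0 -> (forall n, m (E n `*` ~` S2) = 0) -> m (~` S) = 0.
  move=> mS10 mS20; apply/negligibleP; first exact: measurableC.
  apply: (@negligibleS _ _ _ m
      (~` S1 `*` setT `|` \bigcup_n (E n `*` ~` S2))).
    move=> [x1 x2] /= /not_andP[Sx1|Sx2]; first by left.
    have : (\bigcup_n E n) x1 by rewrite -X1E.
    by move=> [n _ Enx]; right; exists n.
  apply: negligibleU; first by apply/negligibleP => //; exact: measurableX.
  apply: negligible_bigcup => n; apply/negligibleP; last exact: mS20.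
  by apply: measurableX => //; have [] := mE n.
have m2ES2 k : m2 (E k `*` ~` S2) = 0.
  by rewrite m2E ?[mu2 _]mu2K2 ?mule0//; have [] := mE k.
have m2S1 : m2 (~` S1 `*` setT) = 0.
  by rewrite m2E// (near aeS1 y)// mul0e.
rewrite -m1E -[RHS]/(m2 A).
apply: (measure_eq_mod_null GM GI GE TE _ m12 mS _ _ GS mA).
(* Finiteness of [m1] on the exhausting sets is read off from [m2], where both factors are
   finite. *)
- move=> n; rewrite m12// m2E//; last by have [] := mE n.
  by rewrite lte_mul_pinfty ?ge0_fin_numE ?(near aeE y)// ltey_eq fin_num_measure.
- apply: nullS => [|n].
    by rewrite m1E (near aeS1T y)// (near aeS1 y)// mul0e.
  by rewrite m1E (near aeES2 y)// mu2K2 mule0.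
- exact: nullS.
Unshelve. all: by end_near. Qed.
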